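(* Let $\mathbf{X}=(\mathbf{x}_1,\dots,\mathbf{x}_p)$ be a real $n\times p$ matrix standardized so that $\|\mathbf{x}_j\|^2/n=1$ for all $j$, and let $\rho_{jk}=\mathbf{x}_j'\mathbf{x}_k/n$. Let $q^*$ be an integer with $2\le q^*\le p$. If $$\max_{|A|=q^*}\ \inf_{\alpha\ge1}\Big\{\sum_{j\in A}\Big(\sum_{k\in A,\,k\ne j}|\rho_{jk}|^{\alpha/(\alpha-1)}\Big)^{\alpha-1}\Big\}^{1/\alpha}\ \le\ \delta\ <\ 1,$$ where the maximum is over subsets $A\subset\{1,\dots,p\}$ of size $q^*$, then the sparse Riesz condition holds with rank $q^*$ and spectrum bounds $c_*=1-\delta$ and $c^*=1+\delta$, that is, $$1-\delta\ \le\ \frac{\|\mathbf{X}_A\mathbf{v}\|^2}{n\|\mathbf{v}\|^2}\ \le\ 1+\delta\qquad\text{for all }A\subset\{1,\dots,p\}\text{ with }|A|=q^*\text{ and all nonzero }\mathbf{v}\in\mathbb{R}^{q^*}.$$ In particular, the same conclusion (with $c_*=1-\delta$, $c^*=1+\delta$) holds if $$\max_{1\le j<k\le p}|\rho_{jk}|\ \le\ \frac{\delta}{q^*-1},\qquad \delta<1.$$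
   Context: $\|\cdot\|$ is the Euclidean norm and $\mathbf{X}_A=(\mathbf{x}_j,j\in A)$ is the submatrix of columns of $\mathbf{X}$ with index in $A$. For $\alpha=1$ the inner expression $(\sum_{k\in A,k\ne j}|\rho_{jk}|^{\alpha/(\alpha-1)})^{\alpha-1}$ is read as its limit as $\alpha\downarrow1$, namely $\max_{k\in A,k\ne j}|\rho_{jk}|$. *)

(* Defs.v *)
From HB Require Import structures.
From mathcomp Require Import all_boot all_order all_algebra.
From mathcomp Require Import all_classical all_reals all_analysis.

Set Implicit Arguments.
Unset Strict Implicit.
Unset Printing Implicit Defensive.

Import Order.TTheory GRing.Theory Num.Theory.

Local Open Scope classical_set_scope.
Local Open Scope ring_scope.

(* The norm that MathComp-Analysis puts on matrices is the
   max norm, hence an explicit Euclidean norm. *)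
Definition enorm (R : realType) (n : nat) (u : 'cV[R]_n) : R :=
  Num.sqrt (\sum_i u i 0 ^+ 2).

Definition standardized (R : realType) (n p : nat) (X : 'M[R]_(n, p)) : Prop :=
  forall j : 'I_p, enorm (col j X) ^+ 2 / n%:R = 1.

Definition rho (R : realType) (n p : nat) (X : 'M[R]_(n, p)) (j k : 'I_p) : R :=
  ((col j X)^T *m col k X) 0 0 / n%:R.

Definition Xsub (R : realType) (n p : nat) (X : 'M[R]_(n, p))
    (A : {set 'I_p}) : 'M[R]_(n, #|A|) :=
  colsub (fun i : 'I_#|A| => enum_val i) X.

(* At alpha = 1 the exponent alpha / (alpha - 1) is infinite; the value there
   is the limit as alpha decreases to 1.  All the quantities below are
   nonnegative and, where used, the index sets are nonempty, so that 0 is a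
   harmless default for the maxima. *)
Definition inner_sum (R : realType) (n p : nat) (X : 'M[R]_(n, p))
    (A : {set 'I_p}) (j : 'I_p) (alpha : R) : R :=
  if alpha == 1 then \big[Num.max/0]_(k in A | k != j) `|rho X j k|
  else (\sum_(k in A | k != j) `|rho X j k| `^ (alpha / (alpha - 1)))
         `^ (alpha - 1).

Definition mixed_norm (R : realType) (n p : nat) (X : 'M[R]_(n, p))
    (A : {set 'I_p}) (alpha : R) : R :=
  (\sum_(j in A) inner_sum X A j alpha) `^ (1 / alpha).

Definition max_inf_mixed (R : realType) (n p : nat) (X : 'M[R]_(n, p))
    (q : nat) : R :=
  \big[Num.max/0]_(A : {set 'I_p} | #|A| == q)
    inf [set mixed_norm X A alpha | alpha in [set alpha : R | 1 <= alpha]].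

Definition max_corr (R : realType) (n p : nat) (X : 'M[R]_(n, p)) : R :=
  \big[Num.max/0]_(jk : 'I_p * 'I_p | (jk.1 < jk.2)%N) `|rho X jk.1 jk.2|.

Definition sparse_Riesz (R : realType) (n p : nat) (X : 'M[R]_(n, p))
    (q : nat) (cmin cmax : R) : Prop :=
  forall A : {set 'I_p}, #|A| = q ->
  forall v : 'cV[R]_#|A|, v != 0 ->
    cmin <= enorm (Xsub X A *m v) ^+ 2 / (n%:R * enorm v ^+ 2) <= cmax.

(* Main.v *)
Require Import Defs.
From mathcomp Require Import all_boot all_order all_algebra.
From mathcomp Require Import all_classical all_reals all_analysis.
From mathcomp Require Import ring lra.

Set Implicit Arguments.
Unset Strict Implicit.
Unset Printing Implicit Defensive.

Import Order.TTheory GRing.Theory Num.Theory.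

Local Open Scope ring_scope.

(* Writing X_A' X_A / n = I + B with B symmetric of zero diagonal, the claim
   says that |<v, B v>| <= delta |v|^2.  By Hoelder, the mixed norm at alpha
   bounds the operator norm of B on l_alpha (on l_1 for alpha = 1), and the
   spectral radius of B is at most any of its operator norms.  The last point
   needs no eigenvectors: by symmetry and Cauchy-Schwarz,
   |B^k v|^4 <= |v|^2 |B^(2k) v|^2, so that |<v, B v>| / |v|^2 is controlled by
   the growth rate of |B^(2^k) v|.  The bound by pairwise correlations follows
   from 2 |v_i v_j| <= v_i^2 + v_j^2. *)

(** * Euclidean inner product and Cauchy-Schwarz *)

Definition dot (R : realType) (m : nat) (u v : 'cV[R]_m) : R :=
  \sum_i u i 0 * v i 0.

Lemma dot_mulmx_adj (R : realType) m1 m2 (Y : 'M[R]_(m1, m2)) (v : 'cV_m2)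
    (w : 'cV_m1) : dot (Y *m v) w = dot v (Y^T *m w).
Proof.
have dotE k (x y : 'cV[R]_k) : dot x y = (x^T *m y) 0 0.
  by rewrite mxE; apply: eq_bigr => i _; rewrite mxE.
by rewrite !dotE trmx_mul mulmxA.
Qed.

Section Dot.
Variables (R : realType) (m : nat).
Implicit Types (u v : 'cV[R]_m) (B : 'M[R]_m).

Lemma enorm_sqr u : enorm u ^+ 2 = dot u u.
Proof.
rewrite /enorm sqr_sqrtr /dot; last by apply: sumr_ge0 => i _; exact: sqr_ge0.
by apply: eq_bigr => i _; rewrite expr2.
Qed.

Lemma dot_ge0 u : 0 <= dot u u.
Proof. by rewrite -enorm_sqr sqr_ge0. Qed.

Lemma dot_gt0 u : u != 0 -> 0 < dot u u.
Proof.
move=> u0; rewrite lt_def dot_ge0 andbT; apply: contraNneq u0 => /eqP.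
rewrite psumr_eq0 => [/allP u0|i _]; last by rewrite -expr2 sqr_ge0.
apply/eqP/matrixP => i j; rewrite ord1 mxE.
by have /= := u0 i (mem_index_enum i); rewrite -expr2 sqrf_eq0 => /eqP.
Qed.

Lemma dot_mulmx B u v : dot u (B *m v) = \sum_i \sum_j B i j * u i 0 * v j 0.
Proof.
by apply: eq_bigr => i _; rewrite mxE big_distrr; apply: eq_bigr => j _ /=; ring.
Qed.

Lemma dot_iter_sym B k u v : B^T = B ->
  dot (iter k (mulmx B) u) v = dot u (iter k (mulmx B) v).
Proof.
by move=> symB; elim: k v => //= k IHk v; rewrite dot_mulmx_adj symB IHk -iterSr.
Qed.

(** Lagrange's identity: the sum of the squares of [u i 0 * v j 0 - u j 0 * v i 0] over all i, j is
    twice the gap between the two sides. *)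
Lemma dot_CauchySchwarz u v : dot u v ^+ 2 <= dot u u * dot v v.
Proof.
have : 0 <= \sum_i \sum_j (u i 0 * v j 0 - u j 0 * v i 0) ^+ 2.
  by do 2!apply: sumr_ge0 => ? _; exact: sqr_ge0.
have -> : \sum_i \sum_j (u i 0 * v j 0 - u j 0 * v i 0) ^+ 2 =
    dot u u * dot v v + dot v v * dot u u - (dot u v * dot u v) *+ 2.
  rewrite /dot !big_distrlr /= -sumrMnl -sumrN -!big_split /=.
  apply: eq_bigr => i _; rewrite -sumrMnl -sumrN -!big_split /=.
  by apply: eq_bigr => j _; ring.
by rewrite expr2; lra.
Qed.

End Dot.

(** * Growth rates and power iteration *)

Lemma Bernoulli_ineq (R : realDomainType) (y : R) k : 0 <= y ->
  1 + k%:R * y <= (1 + y) ^+ k.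
Proof.
move=> y0; elim: k => [|k IHk]; first by rewrite mul0r addr0 expr0.
rewrite exprS -natr1; apply: (@le_trans _ _ ((1 + y) * (1 + k%:R * y))).
  by have := ler0n R k; nra.
by rewrite ler_wpM2l// addr_ge0.
Qed.

(** A constant factor does not affect an exponential growth rate: if x / M = 1 + y with y > 0,
    Bernoulli makes the powers of x / M exceed every C. *)
Lemma ler_of_expr_le (R : archiRealFieldType) (x M C : R) : 0 <= x -> 0 <= M ->
  (forall k, x ^+ (2 ^ k.+1) <= C * M ^+ (2 ^ k.+1)) -> x <= M.
Proof.
move=> x0; rewrite le_eqVlt => /predU1P[<- /(_ 0)|M0 xMC].
  by rewrite expn1 expr0n mulr0 !leNgt; apply: contra => /(exprn_gt0 2).
rewrite leNgt; apply/negP => Mx.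
pose y := x / M - 1.
have y0 : 0 < y by rewrite subr_gt0 ltr_pdivlMr// mul1r.
have yC k : k%:R * y <= C.
  have xE : x = (1 + y) * M by rewrite /y addrC subrK divfK// gt_eqF.
  have := xMC k; rewrite {1}xE exprMn ler_pM2r ?exprn_gt0// => /(le_trans _).
  apply; apply: (@le_trans _ _ ((1 + y) ^+ k)).
    by apply: le_trans (Bernoulli_ineq _ (ltW y0)); rewrite lerDr.
  apply: ler_weXn2l; first by rewrite lerDl ltW.
  by rewrite ltnW// (leq_trans (ltn_expl k (ltnSn 1)))// leq_exp2l.
have := yC (Num.bound (C / y)); rewrite -ler_pdivlMr// leNgt.
by rewrite archi_boundP// divr_ge0 ?(ltW y0)//; have := yC 0; rewrite mul0r.
Qed.

(* Power iteration: Cauchy-Schwarz bounds the powers of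
   [|<v, B v>| / <v, v>] by the growth of [B ^ (2 ^ k) v], which may be
   measured with any function [N] dominating the Euclidean norm up to a
   constant. *)
Lemma rayleigh_le (R : realType) (m : nat) (B : 'M[R]_m) (N : 'cV[R]_m -> R)
    (c M : R) : B^T = B -> 0 <= c -> 0 <= M -> (forall u, 0 <= N u) ->
  (forall u, dot u u <= c * N u ^+ 2) -> (forall u, N (B *m u) <= M * N u) ->
  forall v, `|dot v (B *m v)| <= M * dot v v.
Proof.
move=> symB c0 M0 N0 Nc NM v.
have [->|/dot_gt0 s0] := eqVneq v 0.
  by rewrite /dot !big1 ?normr0 ?mulr0// => i _; rewrite mxE mul0r.
set s := dot v v in s0 *; rewrite -ler_pdivrMr//.
pose w k := iter k (mulmx B) v.
have Nw k : N (w k) <= M ^+ k * N v.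
  elim: k => [|k IHk]; first by rewrite mul1r.
  by rewrite (le_trans (NM _))// exprS -mulrA ler_wpM2l.
apply: (@ler_of_expr_le _ _ _ (c * N v ^+ 2 / s)) => // [|k].
  by rewrite divr_ge0// ltW.
(* The pivot is |B^(2^k) v|^2 / s. The growth of [N] bounds it above; Cauchy-Schwarz, by induction
   on k, bounds it below. *)
apply: (@le_trans _ _ (dot (w (2 ^ k)%N) (w (2 ^ k)%N) / s)); last first.
  rewrite ler_pdivrMr//; apply: le_trans (Nc _) _.
  have -> : c * N v ^+ 2 / s * M ^+ (2 ^ k.+1) * s = c * (M ^+ (2 ^ k) * N v) ^+ 2.
    by rewrite expnSr exprM; field; rewrite gt_eqF.
  by rewrite ler_wpM2l// ler_sqr ?nnegrE ?mulr_ge0 ?exprn_ge0.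
have sqr_div x y : x ^+ 2 <= s * y -> (x / s) ^+ 2 <= y / s.
  move=> xy; rewrite expr_div_n ler_pdivrMr ?exprn_gt0//.
  suff -> : y / s * s ^+ 2 = s * y by [].
  by field; rewrite gt_eqF.
elim: k => [|k IHk].
  by rewrite expn1; apply: sqr_div; rewrite real_normK ?num_real ?dot_CauchySchwarz.
rewrite expnSr exprM.
apply: (@le_trans _ _ ((dot (w (2 ^ k)%N) (w (2 ^ k)%N) / s) ^+ 2)).
  by rewrite ler_sqr ?nnegrE ?exprn_ge0 ?divr_ge0 ?dot_ge0 ?(ltW s0).
apply: sqr_div.
(* By symmetry |B^(2^k) v|^2 = <v, B^(2^(k+1)) v>, so Cauchy-Schwarz against v doubles the
   exponent. *)
rewrite /w dot_iter_sym// -iterD addnn -mul2n -expnS.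
exact: dot_CauchySchwarz.
Qed.

(** * Hoelder's inequality for finite sums *)

(** Divide f and g by their norms and apply Young's inequality termwise: the bounds add up to 1/a +
    1/b = 1. If a norm vanishes, so does every product. *)
Lemma hoelder_sum (R : realType) (I : finType) (P : pred I) (f g : I -> R)
    (a b : R) : 0 < a -> 0 < b -> a^-1 + b^-1 = 1 ->
  `|\sum_(i | P i) f i * g i| <=
    (\sum_(i | P i) `|f i| `^ a) `^ a^-1 * (\sum_(i | P i) `|g i| `^ b) `^ b^-1.
Proof.
move=> a0 b0 ab; set S := \sum_(i | P i) `|f i| `^ a; set T := \sum_(i | P i) _ `^ b.
have S0 : 0 <= S by apply: sumr_ge0 => i _; exact: powR_ge0.
have T0 : 0 <= T by apply: sumr_ge0 => i _; exact: powR_ge0.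
have rhs0 : 0 <= S `^ a^-1 * T `^ b^-1 by rewrite mulr_ge0 ?powR_ge0.
have [S00|Sn0] := eqVneq S 0.
  rewrite big1 ?normr0// => i Pi.
  have /eqP := psumr_eq0P (fun i _ => powR_ge0 _ _) S00 Pi.
  by rewrite powR_eq0 normr_eq0 => /andP[/eqP-> _]; rewrite mul0r.
have [T00|Tn0] := eqVneq T 0.
  rewrite big1 ?normr0// => i Pi.
  have /eqP := psumr_eq0P (fun i _ => powR_ge0 _ _) T00 Pi.
  by rewrite powR_eq0 normr_eq0 => /andP[/eqP-> _]; rewrite mulr0.
have {Sn0} S0 : 0 < S by rewrite lt_def Sn0.
have {Tn0} T0 : 0 < T by rewrite lt_def Tn0.
have s0 : 0 < S `^ a^-1 by exact: powR_gt0.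
have t0 : 0 < T `^ b^-1 by exact: powR_gt0.
have st0 := mulr_gt0 s0 t0; rewrite -[leRHS]mul1r -(ler_pdivrMr _ _ st0).
apply: (@le_trans _ _ (\sum_(i | P i) (`|f i| / S `^ a^-1) * (`|g i| / T `^ b^-1))).
  rewrite ler_pdivrMr// mulr_suml (le_trans (ler_norm_sum _ _ _))//.
  have scale (x y s t : R) : 0 < s -> 0 < t -> x * y = x / s * (y / t) * (s * t).
    by move=> *; field; rewrite !gt_eqF.
  by apply: ler_sum => i _; rewrite normrM [leLHS](scale _ _ _ _ s0 t0).
rewrite -ab.
have -> : a^-1 + b^-1 = \sum_(i | P i) (`|f i| `^ a / S / a + `|g i| `^ b / T / b).
  by rewrite big_split /= -!mulr_suml -/S -/T !divff ?gt_eqF// !mul1r.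
apply: ler_sum => i _; apply: le_trans (conjugate_powR _ _ a0 b0 ab) _.
- exact: divr_ge0 (normr_ge0 _) (powR_ge0 _ _).
- exact: divr_ge0 (normr_ge0 _) (powR_ge0 _ _).
have powRdiv (x y c : R) : 0 <= x -> 0 < y -> 0 < c ->
      (x / y `^ c^-1) `^ c = x `^ c / y.
  move=> x0 y0 c0; rewrite powRM ?invr_ge0 ?powR_ge0//; congr (_ * _).
  rewrite -(powR_inv1 (powR_ge0 _ _)) -!powRrM mulN1r mulrN mulVf ?gt_eqF//.
  by rewrite powR_inv1// ltW.
by apply: lerD; rewrite powRdiv.
Qed.

(** * Quadratic forms of symmetric matrices with zero diagonal *)

Section RayleighMixed.
Variables (R : realType) (m : nat) (B : 'M[R]_m).
Hypotheses (symB : B^T = B) (diagB : forall i, B i i = 0).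

Lemma mulmx_diag0 (u : 'cV[R]_m) i :
  (B *m u) i 0 = \sum_(k | k != i) B i k * u k 0.
Proof. by rewrite mxE (bigD1 i)//= diagB mul0r add0r. Qed.

(** Supplies the constant c = m of [rayleigh_le]; a crude value suffices, since c drops out of the
    growth rate. *)
Lemma dot_le_card (u : 'cV[R]_m) (r : R) : (forall i, `|u i 0| <= r) ->
  dot u u <= m%:R * r ^+ 2.
Proof.
move=> ur; apply: (@le_trans _ _ (\sum_(i < m) r ^+ 2)).
  apply: ler_sum => i _; rewrite -expr2 -real_normK ?num_real//.
  by rewrite ler_sqr ?nnegrE// (le_trans (normr_ge0 _) (ur i)).
by rewrite sumr_const card_ord mulr_natl.
Qed.

(** Power iteration in the l_1 norm: row i of B u is at most the largest off-diagonal |B i k| times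
    the l_1 norm of u. *)
Lemma rayleigh_le_max v :
  `|dot v (B *m v)| <=
    (\sum_i \big[Num.max/0]_(k | k != i) `|B i k|) * dot v v.
Proof.
have max0 i : 0 <= \big[Num.max/0]_(k | k != i) `|B i k| by exact: bigmax_ge_id.
apply: (@rayleigh_le _ _ _ (fun u => \sum_k `|u k 0|) m%:R) => //.
- exact: sumr_ge0.
- by move=> u; exact: sumr_ge0.
- move=> u; apply: dot_le_card => i; rewrite (bigD1 i)//= lerDl.
  exact: sumr_ge0.
- move=> u; rewrite mulr_suml; apply: ler_sum => i _; rewrite mulmx_diag0.
  apply: le_trans (ler_norm_sum _ _ _) _; rewrite mulr_sumr big_mkcond /=.
  apply: ler_sum => k _; case: ifPn => [ki|_]; last by rewrite mulr_ge0.
  by rewrite normrM ler_wpM2r// (le_bigmax_cond 0 (fun k => `|B i k|)).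
Qed.

(** Power iteration in the l_alpha norm: apply Hoelder to each row with exponents alpha / (alpha -
    1) and alpha, raise to the power alpha and sum over the rows. *)
Lemma rayleigh_le_powR (alpha : R) v : 1 < alpha ->
  `|dot v (B *m v)| <=
    (\sum_i (\sum_(k | k != i) `|B i k| `^ (alpha / (alpha - 1)))
              `^ (alpha - 1)) `^ alpha^-1 * dot v v.
Proof.
move=> al1; have al0 : 0 < alpha := lt_trans ltr01 al1.
have alB0 : 0 < alpha - 1 by rewrite subr_gt0.
have S0 (u : 'cV[R]_m) : 0 <= \sum_k `|u k 0| `^ alpha.
  by apply: sumr_ge0 => k _; exact: powR_ge0.
set K := \sum_i _; have K0 : 0 <= K by apply: sumr_ge0 => i _; exact: powR_ge0.
apply: (@rayleigh_le _ _ _ (fun u => (\sum_k `|u k 0| `^ alpha) `^ alpha^-1) m%:R) => //.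
- exact: powR_ge0.
- by move=> u; exact: powR_ge0.
- move=> u; apply: dot_le_card => i.
  rewrite -[leLHS]powRr1// -[X in _ `^ X](@divff _ alpha) ?gt_eqF// powRrM.
  apply: ge0_ler_powR; rewrite ?nnegrE ?invr_ge0 ?powR_ge0 ?(ltW al0)//.
  by rewrite (bigD1 i)//= lerDl sumr_ge0// => k _; exact: powR_ge0.
move=> u; rewrite -powRM//.
apply: ge0_ler_powR; rewrite ?nnegrE ?invr_ge0 ?mulr_ge0 ?(ltW al0)//.
rewrite mulr_suml; apply: ler_sum => i _; rewrite mulmx_diag0.
have conj : (alpha / (alpha - 1))^-1 + alpha^-1 = 1 by field; lra.
have := hoelder_sum (fun k => k != i) (B i) (fun k => u k 0)
  (divr_gt0 al0 alB0) al0 conj.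
set T := \sum_(k | _) `|B i k| `^ _ => le_hoelder.
have T0 : 0 <= T by apply: sumr_ge0 => k _; exact: powR_ge0.
apply: (@le_trans _ _
    ((T `^ (alpha / (alpha - 1))^-1 *
      (\sum_k `|u k 0| `^ alpha) `^ alpha^-1) `^ alpha)).
  apply: ge0_ler_powR; rewrite ?nnegrE ?mulr_ge0 ?powR_ge0 ?(ltW al0)//.
  apply: le_trans le_hoelder _; rewrite ler_wpM2l ?powR_ge0//.
  apply: ge0_ler_powR; rewrite ?nnegrE ?invr_ge0 ?(ltW al0)//.
    by apply: sumr_ge0 => k _; exact: powR_ge0.
  (* Hoelder leaves out k = i; restoring that term only enlarges the sum. *)
  by rewrite [leRHS](bigD1 i)//= lerDr powR_ge0.
rewrite powRM; [|exact: powR_ge0|exact: powR_ge0].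
rewrite -[X in X * _]powRrM -[X in _ * X]powRrM (mulVf (negbT (gt_eqF al0))).
rewrite (powRr1 (S0 u)).
by rewrite invf_div divfK ?gt_eqF.
Qed.

Lemma rayleigh_le_entry (r : R) v : (forall i j, i != j -> `|B i j| <= r) ->
  `|dot v (B *m v)| <= r * (m%:R - 1) * dot v v.
Proof.
move=> Br; rewrite dot_mulmx.
(* The bound r (v_i^2 + v_j^2) / 2 is used for all pairs; the subtracted term cancels it at j = i,
   which turns the factor m into m - 1. *)
apply: (@le_trans _ _ (\sum_i \sum_j (r / 2 * (v i 0 ^+ 2 + v j 0 ^+ 2) -
    (if j == i then r * v i 0 ^+ 2 else 0)))).
  apply: le_trans (ler_norm_sum _ _ _) _; apply: ler_sum => i _.
  apply: le_trans (ler_norm_sum _ _ _) _; apply: ler_sum => j _.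
  have [->|ji] := eqVneq j i; first by rewrite diagB !mul0r normr0; lra.
  rewrite subr0 -mulrA normrM.
  have v2 : `|v i 0 * v j 0| <= (v i 0 ^+ 2 + v j 0 ^+ 2) / 2.
    have := sqr_ge0 (v i 0 + v j 0); have := sqr_ge0 (v i 0 - v j 0).
    by rewrite ler_norml !expr2 => le1 le2; apply/andP; split; lra.
  apply: le_trans (ler_pM _ _ (Br i j _) v2) _; rewrite // 1?eq_sym//.
  by lra.
have -> : \sum_i \sum_j (r / 2 * (v i 0 ^+ 2 + v j 0 ^+ 2) -
    (if j == i then r * v i 0 ^+ 2 else 0)) =
    \sum_i \sum_(j < m) r / 2 * v i 0 ^+ 2 + \sum_(i < m) \sum_j r / 2 * v j 0 ^+ 2
    - \sum_i r * v i 0 ^+ 2.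
  rewrite -sumrN -!big_split; apply: eq_bigr => i _ /=.
  by rewrite sumrB -big_mkcond big_pred1_eq -big_split; congr (_ - _);
    apply: eq_bigr => j _; rewrite mulrDr.
rewrite [X in _ + X - _]exchange_big /=.
under eq_bigr do rewrite sumr_const card_ord.
rewrite !sumrMnl -!mulr_sumr.
have -> : \sum_i v i 0 ^+ 2 = dot v v by apply: eq_bigr => i _; rewrite expr2.
by rewrite -mulr_natr; lra.
Qed.

End RayleighMixed.

(** * The Gram matrix of the selected columns *)

Section Gram.
Variables (R : realType) (n p : nat) (X : 'M[R]_(n, p)).
Hypothesis stdX : standardized X.
Variable A : {set 'I_p}.

(** This is B = X_A' X_A / n - I for standardized X, indexed through [enum_val] as in [Xsub]. *)
Definition offdiag_corr : 'M[R]_#|A| :=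
  \matrix_(i, j) if i == j then 0 else rho X (enum_val i) (enum_val j).

Lemma rhoE j k : rho X j k = (\sum_l X l j * X l k) / n%:R.
Proof.
by rewrite /rho mxE; congr (_ / _); apply: eq_bigr => l _; rewrite !mxE.
Qed.

Lemma rho_sym j k : rho X j k = rho X k j.
Proof. by rewrite !rhoE; congr (_ / _); apply: eq_bigr => l _; rewrite mulrC. Qed.

Lemma rho_diag j : rho X j j = 1.
Proof.
rewrite rhoE -[RHS](stdX j) enorm_sqr; congr (_ / _).
by apply: eq_bigr => l _; rewrite !mxE.
Qed.

Lemma offdiag_corr_sym : offdiag_corr^T = offdiag_corr.
Proof. by apply/matrixP => i j; rewrite !mxE eq_sym rho_sym. Qed.

Lemma offdiag_corr_diag i : offdiag_corr i i = 0.
Proof. by rewrite mxE eqxx. Qed.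

(* For [n = 0] the division by [n%:R = 0] makes [standardized X] fail as soon
   as [X] has a column. *)
Lemma standardized_gt0 : 'I_p -> 0 < n%:R :> R.
Proof.
move=> j; rewrite lt_def ler0n andbT; apply/eqP => n0.
by have := stdX j; rewrite n0 invr0 mulr0 => /eqP; rewrite eq_sym oner_eq0.
Qed.

Lemma Xsub_gram : 0 < n%:R :> R ->
  (Xsub X A)^T *m Xsub X A = n%:R *: (1%:M + offdiag_corr).
Proof.
move=> n0; apply/matrixP => i j; rewrite !mxE.
transitivity (n%:R * rho X (enum_val i) (enum_val j)).
  by rewrite rhoE mulrC divfK ?gt_eqF//; apply: eq_bigr => l _; rewrite !mxE.
by case: eqVneq => [->|_]; rewrite ?rho_diag ?addr0 ?add0r.
Qed.

Lemma enorm_Xsub v : 0 < n%:R :> R ->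
  enorm (Xsub X A *m v) ^+ 2 = n%:R * (dot v v + dot v (offdiag_corr *m v)).
Proof.
move=> n0; rewrite enorm_sqr dot_mulmx_adj mulmxA Xsub_gram//.
rewrite -scalemxAl mulmxDl mul1mx /dot -big_split mulr_sumr.
by apply: eq_bigr => i _; rewrite !mxE /= -mulrDr mulrCA.
Qed.

Lemma enorm_Xsub_bounds delta v : v != 0 ->
  `|dot v (offdiag_corr *m v)| <= delta * dot v v ->
  1 - delta <= enorm (Xsub X A *m v) ^+ 2 / (n%:R * enorm v ^+ 2) <= 1 + delta.
Proof.
(* A nonzero coordinate provides an element of A, hence a column of X, which forces n > 0. *)
move=> v0; have [i _] : exists i, v i 0 != 0.
  by apply/existsP; apply: contraR v0 => /existsPn v0;
    apply/eqP/matrixP => i j; rewrite ord1 mxE; apply/eqP/negPn/v0.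
have n0 := standardized_gt0 (enum_val i).
rewrite enorm_Xsub// enorm_sqr -mulf_div divff ?gt_eqF// mul1r.
have s0 := dot_gt0 v0; rewrite ler_norml => /andP[lo hi].
by rewrite ler_pdivlMr// ler_pdivrMr//; apply/andP; split; lra.
Qed.

Lemma inner_sum_enum_val i alpha : inner_sum X A (enum_val i) alpha =
  if alpha == 1 then \big[Num.max/0]_(k | k != i) `|offdiag_corr i k|
  else (\sum_(k | k != i) `|offdiag_corr i k| `^ (alpha / (alpha - 1)))
         `^ (alpha - 1).
Proof.
rewrite /inner_sum !(big_enum_val_cond (fun k => k != enum_val i)).
have neqE k : (enum_val k != enum_val i) = (k != i).
  by rewrite (inj_eq enum_val_inj).
have rho_corr k : enum_val k != enum_val i ->
    rho X (enum_val i) (enum_val k) = offdiag_corr i k.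
  by rewrite neqE => ki; rewrite mxE eq_sym (negPf ki).
case: (alpha == 1); last apply: (congr1 (@powR R ^~ (alpha - 1))).
  apply: eq_big; first exact: neqE.
  by move=> k /rho_corr ->.
apply: eq_big; first exact: neqE.
by move=> k /rho_corr ->.
Qed.

Lemma rayleigh_le_mixed_norm alpha v : 1 <= alpha ->
  `|dot v (offdiag_corr *m v)| <= mixed_norm X A alpha * dot v v.
Proof.
have symB := offdiag_corr_sym; have diagB := offdiag_corr_diag.
rewrite /mixed_norm big_enum_val div1r.
under eq_bigr do rewrite inner_sum_enum_val.
rewrite le_eqVlt => /predU1P[<-|al1].
  rewrite eqxx invr1 powRr1; first exact: rayleigh_le_max.
  by apply: sumr_ge0 => i _; exact: bigmax_ge_id.
by rewrite gt_eqF//; exact: rayleigh_le_powR.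
Qed.

End Gram.

Theorem proposition1 (R : realType) (n p : nat) (X : 'M[R]_(n, p))
    (hX : standardized X) (q : nat) (hq : (2 <= q <= p)%N)
    (delta : R) (hdelta : delta < 1) :
  (max_inf_mixed X q <= delta -> sparse_Riesz X q (1 - delta) (1 + delta)) /\
  (max_corr X <= delta / (q%:R - 1) ->
     sparse_Riesz X q (1 - delta) (1 + delta)).
Proof.
split=> hle A cardA v v0; apply: enorm_Xsub_bounds => //.
  have s0 := dot_gt0 v0; rewrite -ler_pdivrMr//; apply: le_trans hle.
  apply: le_trans (le_bigmax_cond _ _ (introT eqP cardA)).
  (* The Rayleigh quotient does not depend on alpha, so it is a lower bound of the set of mixed
     norms; alpha = 1 shows that the set is nonempty. *)
  apply: lb_le_inf; first by exists (mixed_norm X A 1), 1 => //=.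
  move=> _ [alpha /= al1 <-]; rewrite ler_pdivrMr//.
  exact: rayleigh_le_mixed_norm.
have q1 : 0 < q%:R - 1 :> R by rewrite subr_gt0 ltr1n; case/andP: hq.
(* Split delta as r (|A| - 1) with r = delta / (q - 1), the form of the entrywise bound. *)
rewrite -[delta](@divfK _ (q%:R - 1)) ?gt_eqF// -{2}cardA.
apply: rayleigh_le_entry; first exact: offdiag_corr_diag.
move=> i j ij; rewrite mxE (negPf ij); apply: le_trans hle.
have {ij} : enum_val i != enum_val j by rewrite (inj_eq enum_val_inj).
(* [max_corr] only sees pairs in increasing order; symmetry of [rho] covers the others. *)
rewrite -val_eqE neq_ltn => /orP[ij|ij]; last rewrite rho_sym.
  exact: (le_bigmax_cond 0 (fun jk => `|rho X jk.1 jk.2|) (j := (_, _))).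
exact: (le_bigmax_cond 0 (fun jk => `|rho X jk.1 jk.2|) (j := (_, _))).
Qed.
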